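(* If $n>4$ or $n=3$, the subgroup $E\wr A_n$ is the monolith of $S_n\wr S_n$. If $n=4$, the monolith of $S_4\wr S_4$ is $E\wr K_4$.
   Context: $S_n\wr S_n=S_n\ltimes S_n^{\,n}$ is the permutational wreath product, the top group $S_n$ permuting the $n$ coordinates of the base $S_n^n$. $E$ is the trivial group; for $H\le S_n$, $E\wr H$ is the subgroup of elements with trivial top permutation and all $n$ base coordinates in $H$. $K_4\lhd S_4$ is the Klein four-group. The monolith of a group is its unique minimal nontrivial normal subgroup (the intersection of all nontrivial normal subgroups, when this is nontrivial). *)

(* Defs.v *)
From HB Require Import structures.
From mathcomp Require Import all_boot all_fingroup all_solvable.

Set Implicit Arguments.
Unset Strict Implicit.
Unset Printing Implicit Defensive.

Local Open Scope group_scope.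

Section PermutationalWreath.

Variables (gT : finGroupType) (n : nat).

Definition wreath_base : finGroupType := {dffun forall _ : 'I_n, gT}.

Implicit Types (x y : wreath_base) (a b : 'S_n).

(* Permutations compose from left to right here, so this is a right action:   *)
(* it moves the coordinate at position i to position a i.                     *)
Definition permute_coords x a : wreath_base := [ffun i => x (a^-1 i)].

Fact permute_coords1 x : permute_coords x 1 = x.
Proof. by apply/ffunP=> i; rewrite ffunE invg1 perm1. Qed.

Fact permute_coordsM x : act_morph permute_coords x.
Proof. by move=> a b; apply/ffunP=> i; rewrite !ffunE invMg permM. Qed.

Canonical coords_action := TotalAction permute_coords1 permute_coordsM.

Fact coords_is_groupAction : is_groupAction [set: wreath_base] coords_action.
Proof.
move=> a _; rewrite /= inE; apply/andP; split.
  by apply/subsetP=> x; rewrite inE.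
apply/morphicP=> x y _ _; rewrite !actpermE /=.
by apply/ffunP=> i; rewrite !ffunE.
Qed.

Canonical coords_groupAction := GroupAction coords_is_groupAction.

(* An element w has top component w.1 : 'S_n and base component w.2.           *)
Definition wreath_prod : finGroupType := sdprod_by coords_groupAction.

Definition wreath (U : {set 'S_n}) (H : {set gT}) : {set wreath_prod} :=
  [set w : sdprod_by coords_groupAction |
    (w.1 \in U) && [forall i, (w.2 : wreath_base) i \in H]].

Fact wreath_group_set (U : {group 'S_n}) (H : {group gT}) :
  group_set (wreath U H).
Proof.
apply/group_setP; split=> [|u v].
  by rewrite inE /= group1; apply/forallP=> i; rewrite ffunE.
rewrite !inE => /andP[Uu /forallP Hu] /andP[Uv /forallP Hv].
rewrite /= groupM //; apply/forallP=> i.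
by rewrite mulg_ffun ffunE groupM.
Qed.

Canonical wreath_group (U : {group 'S_n}) (H : {group gT}) :=
  Group (wreath_group_set U H).

End PermutationalWreath.

(* minnormal already requires M to be a nontrivial group normalised by G.     *)
Definition is_minimal_normal (gT : finGroupType) (G M : {set gT}) : bool :=
  (M \subset G) && minnormal M G.

Definition is_monolith (gT : finGroupType) (G M : {set gT}) : Prop :=
  is_minimal_normal G M /\ forall N : {set gT}, is_minimal_normal G N -> N = M.

Section KleinFour.

Let i0 : 'I_4 := @Ordinal 4 0 isT.
Let i1 : 'I_4 := @Ordinal 4 1 isT.
Let i2 : 'I_4 := @Ordinal 4 2 isT.
Let i3 : 'I_4 := @Ordinal 4 3 isT.

Definition K4 : {set 'S_4} :=
  [set 1; tperm i0 i1 * tperm i2 i3; tperm i0 i2 * tperm i1 i3;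
          tperm i0 i3 * tperm i1 i2].

Fact K4_group_set : group_set K4.
Proof.
have eqS4 (s t : 'S_4) :
  [&& s i0 == t i0, s i1 == t i1, s i2 == t i2 & s i3 == t i3] -> s == t.
  case/and4P=> /eqP e0 /eqP e1 /eqP e2 /eqP e3; apply/eqP/permP.
  case=> -[|[|[|[|//]]]] lti.
  - by rewrite (_ : Ordinal _ = i0) //; apply: val_inj.
  - by rewrite (_ : Ordinal _ = i1) //; apply: val_inj.
  - by rewrite (_ : Ordinal _ = i2) //; apply: val_inj.
  - by rewrite (_ : Ordinal _ = i3) //; apply: val_inj.
apply/group_setP; split=> [|s t]; first by rewrite !inE eqxx.
rewrite !inE -!orbA => /or4P[] /eqP-> /or4P[] /eqP->; apply/or4P;
  by [ apply: Or41; apply: eqS4; do ?rewrite !permE /=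
     | apply: Or42; apply: eqS4; do ?rewrite !permE /=
     | apply: Or43; apply: eqS4; do ?rewrite !permE /=
     | apply: Or44; apply: eqS4; do ?rewrite !permE /= ].
Qed.

Canonical K4_group := Group K4_group_set.

End KleinFour.

(* Main.v *)
Require Import Defs.
From mathcomp Require Import all_boot all_fingroup all_solvable.

(** Both claims follow from one principle ([wreath_monolith]): if G has trivial
    centre and monolith M, and U is a transitive group of degree n, then the
    base group M^n is the monolith of the wreath product of G by U.

    To see this, let N be a nontrivial normal subgroup of the wreath product.
    Commutators push N into smaller and smaller parts of the base group. If w in
    N moves the coordinate i, its commutator with a base element supported at i
    lies in the base group and is nontrivial, because the conjugate of that
    element by w is supported elsewhere. If a base element x of N has x_i <> 1,
    then x_i is not central in G, so commuting x with a suitable element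
    supported at i gives a nontrivial element of N supported at i alone. The
    elements g of G whose copy at coordinate i lies in N form therefore a
    nontrivial normal subgroup of G, which contains M; transitivity of U carries
    this copy of M to all the other coordinates, and these copies generate M^n.

    What remains is the monolith of the symmetric group, of which the centre is
    trivial from degree 3 on.

    When the alternating group A is simple, a normal subgroup N that does not
    contain A meets it trivially; the commutator of N with the symmetric group
    lies in both N and A, so N is central ([simple_Alt_monolith]).

    In degree 4, the Klein group is normal, abelian and transitive, and any such
    subgroup R is the monolith ([transitive_abelian_monolith]): it is its own
    centraliser and acts regularly, so a transposition fixing a point x and
    exchanging s x and t x conjugates s to t, for all s, t <> 1 in R. Normality
    is read off a conjugation invariant description of the Klein group: its
    nontrivial elements are the fixed point free involutions ([K4P]). *)

Set Implicit Arguments.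
Unset Strict Implicit.
Unset Printing Implicit Defensive.

Local Open Scope group_scope.

(** * Monoliths *)

Lemma minimal_normal_group_set (gT : finGroupType) (G M : {set gT}) :
  is_minimal_normal G M -> group_set M.
Proof. by case/andP=> _ /minsetp/andP[]. Qed.

(** In a finite group every nontrivial normal subgroup contains a minimal one,
    so a unique minimal normal subgroup lies below all of them. *)
Lemma monolithP (gT : finGroupType) (G M : {group gT}) :
  is_monolith G M <->
  [/\ M <| G, M :!=: 1
    & forall N : {group gT}, N <| G -> N :!=: 1 -> M \subset N].
Proof.
split=> [[/andP[sMG /mingroupp/andP[ntM nMG]] uniqM]|[nsMG ntM leM]].
  split=> // [|N /andP[sNG nNG] ntN]; first exact/andP.
  have [L minL sLN] : {L : {group gT} | minnormal L G & L \subset N}.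
    by apply: mingroup_exists; rewrite ntN.
  rewrite -(uniqM L) //; apply/andP; split=> //.
  exact: subset_trans sLN sNG.
have /andP[sMG nMG] := nsMG.
have minM : minnormal M G.
  apply/mingroupP; split=> [|N /andP[ntN nNG] sNM]; first by rewrite ntM.
  apply/eqP; rewrite eqEsubset sNM leM //.
  by rewrite /normal (subset_trans sNM).
split=> [|N minN]; first exact/andP.
have defN := gen_set_id (minimal_normal_group_set minN).
move: minN; rewrite -defN => /andP[sNG /mingroupP[/andP[ntN nNG] minN]].
by symmetry; apply: minN; rewrite ?ntM //= leM // /normal sNG.
Qed.

(** * Wreath products *)

Section Wreath.

Variables (gT : finGroupType) (n : nat).
Implicit Types (i j : 'I_n) (g h : gT) (x y : wreath_base gT n) (a : 'S_n).
Implicit Types (w v : wreath_prod gT n).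
Implicit Types (U : {group 'S_n}) (G H M : {group gT}).

Definition base x : wreath_prod gT n := sdpair1 (coords_groupAction gT n) x.
Definition top a : wreath_prod gT n := sdpair2 (coords_groupAction gT n) a.

Definition at_coord i g : wreath_base gT n := @dfung1 'I_n (fun=> gT) i g.

Lemma wreathE w : exists a, exists x : wreath_base gT n, w = top a * base x.
Proof. by case: w => -[a x] ax; exists a, x; apply: sdpairE. Qed.

Lemma baseM : {morph base : x y / x * y}.
Proof. by move=> x y; apply: sdpair1_morphM; rewrite inE. Qed.

Lemma base1 : base 1 = 1.
Proof. exact: morph1 (sdpair1_morphism _). Qed.

Lemma top1 : top 1 = 1.
Proof. exact: morph1 (sdpair2_morphism _). Qed.

Lemma baseV x : base x^-1 = (base x)^-1.
Proof. by apply: (morphV (sdpair1_morphism _)); rewrite inE. Qed.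

Lemma baseJ x y : base (x ^ y) = base x ^ base y.
Proof. by rewrite /conjg !baseM baseV. Qed.

Lemma base_top x a : base x ^ top a = base (permute_coords x a).
Proof. by rewrite /base /top -sdpair_act ?inE. Qed.

Lemma base_eq1 x : (base x == 1) = (x == 1).
Proof. by rewrite (morph_injm_eq1 (injm_sdpair1 _)) ?inE. Qed.

Lemma mem_wreath U H a x :
  (top a * base x \in wreath U H) = (a \in U) && [forall i, x i \in H].
Proof.
rewrite inE /= !val_insubd !inE /= mulg1; congr (_ && _).
by apply: eq_forallb=> i; rewrite mulg_ffun !ffunE mul1g.
Qed.

Lemma mem_base U H x : (base x \in wreath U H) = [forall i, x i \in H].
Proof. by rewrite -[base x]mul1g -top1 mem_wreath group1. Qed.

Lemma mem_top U H a : (top a \in wreath U H) = (a \in U).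
Proof.
rewrite -[top a]mulg1 -base1 mem_wreath.
by rewrite (_ : [forall _, _]) ?andbT //; apply/forallP=> i; rewrite ffunE.
Qed.

Lemma wreath1P H w :
  reflect (exists2 x : wreath_base gT n, forall i, x i \in H & w = base x)
          (w \in wreath 1 H).
Proof.
apply: (iffP idP) => [|[x Hx ->]]; last first.
  by rewrite (mem_base 1%G); apply/forallP.
have [a [x ->]] := wreathE w.
rewrite (mem_wreath 1%G) inE => /andP[/eqP-> /forallP Hx].
by exists x; rewrite // top1 mul1g.
Qed.

Lemma at_coordE i g j : at_coord i g j = if i == j then g else 1.
Proof.
by have [<-|neq_ij] := eqVneq i j; [apply: dfung1_id | apply: dfung1_dflt].
Qed.

Lemma at_coordM i : {morph at_coord i : g h / g * h}.
Proof. exact: dfung1_morphM. Qed.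

Lemma at_coord1 i : at_coord i 1 = 1.
Proof. exact: morph1 (dfung1_morphism _ _). Qed.

Lemma at_coordV i g : at_coord i g^-1 = (at_coord i g)^-1.
Proof. by apply: (morphV (dfung1_morphism _ _)); rewrite inE. Qed.

Lemma at_coord_eq1 i g : (at_coord i g == 1) = (g == 1).
Proof.
apply/eqP/eqP=> [/ffunP/(_ i)|->]; last exact: at_coord1.
by rewrite at_coordE eqxx ffunE.
Qed.

Lemma at_coordJ i g x : at_coord i g ^ x = at_coord i (g ^ x i).
Proof.
apply/ffunP=> j; rewrite 2!mulg_ffun invg_ffun !at_coordE /=.
by case: eqP => [<- //|_]; rewrite mul1g mulVg.
Qed.

Lemma at_coordR i g x : [~ x, at_coord i g] = at_coord i [~ x i, g].
Proof. by rewrite !commgEr -at_coordV at_coordJ -at_coordM. Qed.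

Lemma permute_at_coord i g a :
  permute_coords (at_coord i g) a = at_coord (a i) g.
Proof.
apply/ffunP=> j; rewrite ffunE !at_coordE.
by rewrite -(inj_eq (@perm_inj _ a)) permKV.
Qed.

Lemma prod_at_coord x : x = \prod_j at_coord j (x j).
Proof.
apply/ffunP=> j; rewrite prodg_ffun (big_only1 j) ?at_coordE ?eqxx //.
by move=> k; rewrite at_coordE => /negPf->.
Qed.

Lemma mem_base_at_coord U H i g :
  g \in H -> base (at_coord i g) \in wreath U H.
Proof.
by move=> Hg; rewrite mem_base; apply/forallP=> j; rewrite at_coordE; case: eqP.
Qed.

Lemma wreath_normal U G M : M <| G -> wreath 1 M <| wreath U G.
Proof.
case/andP=> sMG nMG; apply/andP; split.
  apply/subsetP=> _ /wreath1P[x Mx ->]; rewrite mem_base.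
  by apply/forallP=> i; apply: (subsetP sMG).
apply/subsetP=> v Wv; rewrite inE.
apply/subsetP=> _ /imsetP[_ /wreath1P[x Mx ->] ->].
have [a [y def_v]] := wreathE v; move: Wv.
rewrite {}def_v mem_wreath => /andP[_ /forallP Gy].
rewrite conjgM base_top -baseJ; apply/wreath1P; eexists; last by [].
move=> i; rewrite 2!mulg_ffun invg_ffun ffunE.
by rewrite -/(x (a^-1 i) ^ y i) memJ_norm // (subsetP nMG).
Qed.

Section NormalSubgroup.

Variables (U : {group 'S_n}) (G : {group gT}) (N : {group wreath_prod gT n}).
Hypotheses (nsNW : N <| wreath U G) (ntN : N :!=: 1).

Let memNJ w v : v \in wreath U G -> (w ^ v \in N) = (w \in N).
Proof. by move=> Wv; rewrite memJ_norm // (subsetP (normal_norm nsNW)). Qed.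

Let memNR w v : w \in N -> v \in wreath U G -> [~ w, v] \in N.
Proof. by move=> Nw Wv; rewrite commgEl groupM ?memNJ ?groupV. Qed.

(** The commutator of w with an element supported at a coordinate that w moves
    is a product of two base elements with different singleton supports. *)
Lemma normal_meets_base : G :!=: 1 -> exists2 x, x != 1 & base x \in N.
Proof.
case/trivgPn=> g Gg ntg; have /trivgPn[w Nw ntw] := ntN.
have [a [x def_w]] := wreathE w.
have [a1|/eqP nta] := eqVneq a 1.
  have {}def_w : w = base x by rewrite def_w a1 top1 mul1g.
  by exists x; rewrite -?base_eq1 -def_w.
have [i nti] : exists i, a i != i.
  apply/existsP; apply: contra_notT nta; rewrite negb_exists => /forallP fixa.
  by apply/permP=> i; rewrite perm1; apply/eqP; rewrite -[_ == _]negbK fixa.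
have := memNR Nw (mem_base_at_coord U i Gg).
rewrite commgEr -baseV {1}def_w conjgM base_top -baseJ -baseM.
rewrite -at_coordV permute_at_coord at_coordJ => Nz.
eexists; last exact: Nz.
apply: contraNneq ntg => /ffunP/(_ i).
by rewrite mulg_ffun !at_coordE eqxx (negPf nti) mul1g ffunE => ->.
Qed.

Lemma normal_meets_coordinate :
    'Z(G) = 1 -> G :!=: 1 ->
  exists i, exists2 g, g \in G & (g != 1) && (base (at_coord i g) \in N).
Proof.
move=> cG1 ntG; have [x ntx Nx] := normal_meets_base ntG.
have /forallP Gx : [forall i, x i \in G].
  by rewrite -(mem_base U) (subsetP (normal_sub nsNW)).
have [i ntxi] : exists i, x i != 1.
  apply/existsP; apply: contraNT ntx; rewrite negb_exists => /forallP x1.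
  by apply/eqP/ffunP=> i; rewrite ffunE; apply/eqP; rewrite -[_ == _]negbK x1.
have [h Gh ncxh] : exists2 h, h \in G & [~ x i, h] != 1.
  apply/exists_inP; apply: contraNT ntxi.
  rewrite negb_exists_in => /forall_inP cx.
  rewrite -in_set1 -[[set 1]]cG1 inE Gx; apply/centP=> h Gh.
  by apply/commgP; rewrite -[_ == _]negbK cx.
exists i, [~ x i, h]; rewrite ?groupR ?Gx //=.
by rewrite ncxh -at_coordR /commg baseM baseV baseJ memNR ?mem_base_at_coord.
Qed.

End NormalSubgroup.

Lemma wreath_monolith U G M :
    [transitive U, on [set: 'I_n] | 'P] -> 'Z(G) = 1 -> is_monolith G M ->
  is_monolith (wreath U G) (wreath 1 M).
Proof.
move=> trU cG1 /monolithP[nsMG ntM leM].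
have /trivgPn[m Mm ntm] := ntM.
have ntG : G :!=: 1.
  by apply/trivgPn; exists m; rewrite // (subsetP (normal_sub nsMG)).
apply/(monolithP (wreath_group U G) (wreath_group 1 M)); split.
- exact: wreath_normal.
(* A transitive group has an orbit, so there is at least one coordinate. *)
- have /imsetP[i _ _] := trU.
  apply/trivgPn; exists (base (at_coord i m)).
    exact: (mem_base_at_coord 1%G).
  by rewrite base_eq1 at_coord_eq1.
move=> N nsNW ntN.
have [i [g Gg /andP[ntg Ng]]] := normal_meets_coordinate nsNW ntN cG1 ntG.
have nNW := subsetP (normal_norm nsNW).
have gK : group_set [set h in G | base (at_coord i h) \in N].
  apply/group_setP; split=> [|h k].
    by rewrite inE group1 at_coord1 base1 group1.
  rewrite !inE => /andP[Gh Nh] /andP[Gk Nk].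
  by rewrite groupM // at_coordM baseM groupM.
pose K := Group gK.
have sMK : M \subset K.
  apply: leM; last by apply/trivgPn; exists g; rewrite // inE Gg.
  apply/andP; split; first by apply/subsetP=> h /setIdP[].
  apply/subsetP=> k Gk; rewrite inE.
  apply/subsetP=> _ /imsetP[h /setIdP[Gh Nh] ->].
  have -> : h ^ k = h ^ at_coord i k i by rewrite at_coordE eqxx.
  rewrite inE {1}at_coordE eqxx groupJ // -at_coordJ baseJ.
  by rewrite memJ_norm // nNW // mem_base_at_coord.
have Nat j h : h \in M -> base (at_coord j h) \in N.
  move=> Mh; have [a Ua /= ->] := atransP2 trU (in_setT i) (in_setT j).
  rewrite apermE -permute_at_coord -base_top memJ_norm ?nNW ?mem_top //.
  by have /setIdP[] := subsetP sMK h Mh.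
apply/subsetP=> _ /wreath1P[x Mx ->].
rewrite (prod_at_coord x) (big_morph base baseM base1).
by apply: group_prod => j _; apply: Nat.
Qed.

End Wreath.

(** * Normal subgroups of the symmetric group *)

Section Symmetric.

Variable T : finType.
Implicit Types (s t : {perm T}) (x y z : T) (R : {group {perm T}}).

Lemma perm_moves s : s != 1 -> exists x, s x != x.
Proof.
move=> nts; apply/existsP; apply: contraNT nts.
rewrite negb_exists => /forallP s1.
by apply/eqP/permP=> x; rewrite perm1; apply/eqP; rewrite -[_ == _]negbK s1.
Qed.

(** If s moves x and y is a third point, then s does not commute with the
    transposition of s x and y. *)
Lemma Sym_center : 2 < #|T| -> 'Z('Sym_T) = 1.
Proof.
move=> T3; apply/trivgP/subsetP=> s /centerP[_ cs]; rewrite inE.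
apply/negPn/negP=> /perm_moves[x nsx].
have [y] : exists y, y \notin [set x; s x].
  apply/existsP; rewrite -negb_forall; apply: contraL T3 => /forallP all2.
  rewrite -leqNgt -cardsT; apply: leq_trans (_ : #|[set x; s x]| <= 2).
    by apply/subset_leq_card/subsetP=> y _; apply: all2.
  by rewrite cards2; case: (_ != _).
rewrite !inE negb_or => /andP[nyx nysx].
have /permP/(_ x) := cs (tperm (s x) y) (in_setT _).
rewrite !permM tpermL tpermD // => eq_y.
by rewrite eq_y eqxx in nysx.
Qed.

Lemma Sym_transitive : 0 < #|T| -> [transitive 'Sym_T, on [set: T] | 'P].
Proof.
case/card_gt0P=> x _; apply/imsetP; exists x => //.
apply/setP=> y; rewrite inE; symmetry.
by apply/orbitP; exists (tperm x y); rewrite ?inE //= apermE tpermL.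
Qed.

Lemma simple_Alt_monolith :
  2 < #|T| -> simple 'Alt_T -> is_monolith 'Sym_T 'Alt_T.
Proof.
move=> T3 /simpleP[ntA simA].
apply/(monolithP (Sym_group T) (Alt_group T)); split=> //.
  exact: Alt_normal.
move=> N /andP[sNS nNS] ntN.
have [|tiNA|<-] := simA (N :&: 'Alt_T)%G; last exact: subsetIl.
  rewrite /normal subsetIr /= normsI ?normG //.
  exact: subset_trans (Alt_subset T) nNS.
case/negP: ntN; rewrite -subG1 -(Sym_center T3) subsetI sNS.
rewrite /= centsC; apply/commG1P/trivgP.
rewrite -[1]tiNA subsetI commg_subr nNS.
have der1A : ('Sym_T)^`(1) \subset 'Alt_T.
  apply: der1_min; first exact: Alt_norm.
  apply: cyclic_abelian; apply: prime_cyclic.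
  by rewrite card_quotient ?Alt_norm // Alt_index // ltnW.
by apply: subset_trans der1A; rewrite commgS.
Qed.

(** The fixed points of s form a set invariant under the centraliser of s. *)
Lemma transitive_cent_fix R s x :
  [transitive R, on [set: T] | 'P] -> s \in 'C(R) -> s x = x -> s = 1.
Proof.
move=> trR cRs sx; apply/permP=> y; rewrite perm1.
have [r Rr ->] := atransP2 trR (in_setT x) (in_setT y).
by rewrite /= apermE -permM -(centP cRs) // permM sx.
Qed.

(** If s centralises R, some r in R agrees with s at a chosen point; as R is
    abelian, s * r^-1 also centralises R, and it fixes that point. *)
Lemma transitive_abelian_cent R :
  [transitive R, on [set: T] | 'P] -> abelian R -> 'C(R) \subset R.
Proof.
move=> trR abR; have /imsetP[x _ _] := trR; apply/subsetP=> s cRs.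
have [r Rr /= rx] := atransP2 trR (in_setT x) (in_setT (s x)).
suff -> : s = r by [].
apply/eqP; rewrite eq_mulgV1; apply/eqP.
apply: (transitive_cent_fix (x := x) trR).
  by rewrite groupM ?groupV // (subsetP abR).
by rewrite permM rx apermE permK.
Qed.

Lemma transitive_abelian_monolith R :
    R <| 'Sym_T -> R :!=: 1 -> [transitive R, on [set: T] | 'P] -> abelian R ->
  is_monolith 'Sym_T R.
Proof.
move=> nsRS ntR trR abR; apply/(monolithP (Sym_group T)); split=> // N.
case/andP=> sNS nNS ntN; have /andP[sRS nRS] := nsRS.
have cRR := subsetP abR.
(* If N met R trivially it would centralise R, hence be contained in R. *)
have [s /setIP[Ns Rs] nts] : exists2 s, s \in N :&: R & s != 1.
  apply/trivgPn; apply: contraNneq ntN => tiNR.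
  rewrite -subG1 -tiNR subsetI subxx.
  apply: subset_trans (transitive_abelian_cent trR abR).
  apply/commG1P/trivgP; rewrite -tiNR.
  apply: commg_subI; rewrite subsetI subxx //=.
    exact: subset_trans nRS.
  exact: subset_trans nNS.
apply/subsetP=> t Rt; have [-> //|ntt] := eqVneq t 1.
have [x nsx] := perm_moves nts.
have ntx : t x != x.
  apply: contraNneq ntt => tx.
  by rewrite (transitive_cent_fix trR (cRR t Rt) tx).
have [p px psx] : exists2 p : {perm T}, p x = x & p (s x) = t x.
  by exists (tperm (s x) (t x)); rewrite ?tpermL ?tpermD.
have Sp : p \in 'Sym_T by rewrite inE.
suff <- : s ^ p = t by rewrite memJ_norm // (subsetP nNS).
(* Both sides lie in R and send x to t x. *)
apply/eqP; rewrite eq_mulgV1; apply/eqP.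
apply: (transitive_cent_fix (x := x) trR).
  by rewrite cRR // groupM ?groupV // memJ_norm // (subsetP nRS).
by rewrite permM -{1}px permJ psx permK.
Qed.

End Symmetric.

(** * The Klein four-group *)

Definition fixed_point_free_involution (T : finType) (s : {perm T}) : Prop :=
  forall x, s (s x) = x /\ s x != x.

(** For y outside the common pair {x, s x}, both s y and t y have to be the
    fourth point. *)
Lemma fixed_point_free_involution_eq (T : finType) (s t : {perm T}) x :
    #|T| = 4 ->
    fixed_point_free_involution s -> fixed_point_free_involution t ->
  s x = t x -> s = t.
Proof.
move=> T4 invs invt eq_x; apply/permP=> y.
have [[sx nsx] [sy nsy]] := (invs x, invs y).
have [[tx ntx] [ty nty]] := (invt x, invt y).
have [-> //|nyx] := eqVneq y x.
have [->|nysx] := eqVneq y (s x); first by rewrite sx eq_x tx.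
have /cards1P[z defz] : #|~: [set x; s x; y]| == 1%N.
  rewrite -(eqn_add2l #|[set x; s x; y]|) cardsC T4.
  by rewrite setUC cardsU1 cards2 !inE negb_or nyx nysx (eq_sym x) nsx.
have [] : s y \in [set z] /\ t y \in [set z]; last by move=> /set1P-> /set1P->.
rewrite -defz !inE !negb_or nsy nty !andbT {2}eq_x !(inj_eq perm_inj) nyx.
rewrite !andbT; split; first by apply: contraNneq nysx => <-; rewrite sy.
by apply: contraNneq nysx; rewrite eq_x => <-; rewrite ty.
Qed.

Lemma K4_transitive : [transitive K4, on [set: 'I_4] | 'P].
Proof.
pose i0 : 'I_4 := @Ordinal 4 0 isT.
apply/imsetP; exists i0 => //; apply/setP=> i; rewrite inE; symmetry.
rewrite /orbit /K4 /= !imsetU !imset_set1 !inE -!orbA !apermE.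
case: i => -[|[|[|[|//]]]] lti; apply/or4P.
- by apply: Or41; rewrite perm1.
- by apply: Or42; do ?rewrite !permE /=.
- by apply: Or43; do ?rewrite !permE /=.
- by apply: Or44; do ?rewrite !permE /=.
Qed.

(** Transitivity provides, for each fixed point free involution, an element of
    the Klein group that agrees with it at a point, hence everywhere. *)
Lemma K4P (s : 'S_4) :
  reflect (s = 1 \/ fixed_point_free_involution s) (s \in K4).
Proof.
have K4_cases k : k \in K4 -> k = 1 \/ fixed_point_free_involution k.
  rewrite !inE -!orbA => /or4P[]/eqP->; [by left | right | right | right];
    case=> -[|[|[|[|//]]]] lti; do ?rewrite !permE /=;
    by split=> //; apply: val_inj.
apply: (iffP idP) => [/K4_cases //|[->|invs]]; first exact: (group1 K4_group).
have [k Kk /= k0] := atransP2 K4_transitive (in_setT ord0) (in_setT (s ord0)).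
have [k1|invk] := K4_cases k Kk.
  by have [_] := invs ord0; rewrite k0 k1 apermE perm1 eqxx.
by rewrite (fixed_point_free_involution_eq _ invs invk k0) // card_ord.
Qed.

Lemma K4_normal : K4 <| 'Sym_('I_4).
Proof.
rewrite /normal subsetT /=; apply/subsetP=> a _; rewrite inE.
apply/subsetP=> _ /imsetP[s /K4P Ks ->]; apply/K4P.
case: Ks => [->|invs]; [by left; rewrite conj1g | right=> i].
have [ssi nsi] := invs (a^-1 i).
have sJE j : (s ^ a) j = a (s (a^-1 j)) by rewrite -{1}[j](permKV a) permJ.
rewrite !sJE permK ssi permKV; split=> //.
by rewrite -{2}(permKV a i) (inj_eq perm_inj).
Qed.

(** A group in which every element is its own inverse is abelian. *)
Lemma K4_abelian : abelian K4.
Proof.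
have invK (s : 'S_4) : s \in K4 -> s^-1 = s.
  case/K4P=> [->|invs]; first by rewrite invg1.
  apply/eqP; rewrite eq_invg_mul; apply/eqP/permP=> i.
  by rewrite permM perm1; case: (invs i).
apply/centsP=> s Ks t Kt; red.
by rewrite -{1}(invK s) // -{1}(invK t) // -invMg invK // groupM.
Qed.

Lemma K4_nontrivial : K4 != 1.
Proof.
have [k Kk /= k0] := atransP2 K4_transitive (in_setT ord0) (in_setT ord_max).
apply/(trivgPn K4_group); exists k => //.
by apply: contra_eq_neq k0 => ->; rewrite apermE perm1.
Qed.

(** * The monolith of the wreath product of symmetric groups *)

Theorem corollary10 :
  (forall n : nat, 4 < n \/ n = 3 ->
     is_monolith (wreath 'Sym_('I_n) 'Sym_('I_n)) (wreath 1 'Alt_('I_n)))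
  /\ is_monolith (wreath 'Sym_('I_4) 'Sym_('I_4)) (wreath 1 K4).
Proof.
split=> [n n_big|].
  have n3 : 2 < #|'I_n| by rewrite card_ord; case: n_big => [/ltnW/ltnW|->].
  apply: (@wreath_monolith _ _ 'Sym_('I_n) 'Sym_('I_n) 'Alt_('I_n)).
  - by apply: Sym_transitive; apply: leq_trans n3.
  - exact: Sym_center.
  apply: simple_Alt_monolith => //; case: n_big => [n5|n_eq3].
    by apply: simple_Alt5; rewrite card_ord.
  by apply: simple_Alt_3; rewrite card_ord.
apply: (@wreath_monolith _ _ 'Sym_('I_4) 'Sym_('I_4) K4_group).
- by apply: Sym_transitive; rewrite card_ord.
- by apply: Sym_center; rewrite card_ord.
apply: (@transitive_abelian_monolith _ K4_group).
- exact: K4_normal.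
- exact: K4_nontrivial.
- exact: K4_transitive.
- exact: K4_abelian.
Qed.
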